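(* For the online Submodular Welfare Maximization problem in the random order model, the Greedy algorithm has competitive ratio at least $0.5052$. That is, for every instance, the expected welfare of the Greedy allocation (expectation over the uniformly random arrival order) is at least $0.5052 \cdot \mathrm{OPT}$, where $\mathrm{OPT}$ is the maximum social welfare of the instance.
   Context: Online Submodular Welfare Maximization (online SWM): there is a set $N$ of $n$ items and a set $M$ of $m$ agents. Each agent $\ell$ has a valuation $v_\ell:2^N\to\mathbb{R}_{\ge 0}$ that is monotone ($S\subseteq T\Rightarrow v_\ell(S)\le v_\ell(T)$), submodular, and normalized ($v_\ell(\emptyset)=0$). Items arrive one at a time and each must be assigned irrevocably to an agent on arrival, before later items are seen. The welfare of a final assignment $S_1,\dots,S_m$ (disjoint sets) is $\sum_\ell v_\ell(S_\ell)$; $\mathrm{OPT}$ is the maximum welfare over all partitions of $N$. In the random order model the arrival order is a uniformly random permutation of $N$. The Greedy algorithm assigns each arriving item $j$ to an agent $\ell$ maximizing the marginal gain $v_\ell(S_\ell\cup\{j\})-v_\ell(S_\ell)$, where $S_\ell$ is the set currently assigned to $\ell$. The competitive ratio is the infimum over instances of $\mathbb{E}[\text{welfare of Greedy}]/\mathrm{OPT}$. *)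

(* Defs.v *)
From HB Require Import structures.
From mathcomp Require Import all_boot all_order all_algebra all_fingroup.
From mathcomp Require Import reals.

Set Implicit Arguments.
Unset Strict Implicit.
Unset Printing Implicit Defensive.

Import Order.TTheory GRing.Theory Num.Theory.
Local Open Scope ring_scope.

Section Instance.
Variables (R : realType) (M N : finType).
Implicit Types (f : {set N} -> R) (v : M -> {set N} -> R).

Definition monotone f := forall S T : {set N}, S \subset T -> f S <= f T.

Definition submodular f :=
  forall S T : {set N}, f (S :|: T) + f (S :&: T) <= f S + f T.

Definition valuation f :=
  [/\ forall S, 0 <= f S, f set0 = 0, monotone f & submodular f].

Definition marginal f (S : {set N}) (j : N) : R := f (j |: S) - f S.

Definition welfare v (S : M -> {set N}) : R := \sum_(l : M) v l (S l).

(* A partition of N into bundles indexed by M (some possibly empty) is encoded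
   as the map a sending each item to its owner. Welfare is nonnegative, so the
   default value 0 of the maximum is harmless. *)
Definition OPT v : R :=
  \big[Num.max/0]_(a : {ffun N -> M}) welfare v (fun l => [set j | a j == l]).

(* g h j is the agent receiving the item j when the items that have arrived
   before j are, in this order, those of h. *)
Definition online_rule := seq N -> N -> M.

(* The bundle of agent l once the (pairwise distinct) items of s have arrived
   in this order; take (index j s) s lists the items preceding j in s. *)
Definition bundle (g : online_rule) (s : seq N) (l : M) : {set N} :=
  [set j in s | g (take (index j s) s) j == l].

(* Ties are broken by g in an arbitrary, possibly history-dependent, way. *)
Definition greedy v (g : online_rule) :=
  forall (h : seq N) (j : N), uniq (rcons h j) -> forall l : M,
    marginal (v l) (bundle g h l) j
      <= marginal (v (g h j)) (bundle g h (g h j)) j.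

Definition arrival_order (s : {perm N}) : seq N := [seq s i | i <- enum N].

Definition expected_welfare v (g : online_rule) : R :=
  (\sum_(s : {perm N}) welfare v (bundle g (arrival_order s)))
    / #|{: {perm N}}|%:R.

Lemma bundle_nil g l : bundle g [::] l = set0.
Proof. by apply/setP => i; rewrite !inE. Qed.

Lemma bundle_rcons g h j l : uniq (rcons h j) ->
  bundle g (rcons h j) l =
  if g h j == l then j |: bundle g h l else bundle g h l.
Proof.
rewrite rcons_uniq => /andP[jh _].
have E i : (i \in bundle g (rcons h j) l) =
    (i == j) && (g h j == l) || (i \in bundle g h l).
  rewrite !inE mem_rcons inE -cats1 index_cat take_cat.
  have [->|ij] /= := eqVneq i j.
    by rewrite (negbTE jh) /= eqxx addn0 ltnn subnn cats0 orbF.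
  by case: (boolP (i \in h)) => //= ih; rewrite index_mem ih.
by apply/setP => i; rewrite E; case: ifP => _; rewrite ?andbF // andbT in_setU1.
Qed.

End Instance.

(* Main.v *)
Require Import Defs.
From mathcomp Require Import all_boot all_order all_algebra all_fingroup.
From mathcomp Require Import reals.
From mathcomp Require Import zify ring lra.

Import Order.TTheory GRing.Theory Num.Theory.
Local Open Scope ring_scope.

(* View an allocation as a set of pairs (agent, item), on which welfare is a
   monotone submodular f, and let F i be the expected welfare of Greedy after i
   of the n arrivals, A(h) the Greedy set on the sequence h, O(h) the optimum
   restricted to h, with f(O) = 1.

   Charging every item of a competing solution to the Greedy gain at its arrival
   gives f(A(h) u O(rest)) >= 1 - f(A(h)), so the next arrival gains at least
   (1 - 2 F i) / (n - i) on average, whence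
   1 - 2 F i <= (n - i)(n - i - 1) / (n (n - 1)).  This alone yields 1/2.

   To beat 1/2, split the arrivals as h1, ha, hb and let h2 = ha, hb.  The
   allocation A(h2) of a fresh Greedy run on h2 is an alternative to O(h2):
   charging O(h2) and the hb-part of A(h2) simultaneously gives
   3 F n >= F r + F t + E f(A(h1) u O(h2) u A(h2)|hb).  Adding the same bound
   with ha and hb exchanged and using submodularity replaces A(h2)|hb and
   A(h2)|ha by the full A(h2), and f(A(h2) u O(h2)) is large because A(h2) is
   charged against O(h1) in the order h2, h1.  The outcome is
   8 F n >= 2 + F r + F (r + m1) + F (r + m2) + 2 F (m1 + m2). *)

(** * Monotone submodular set functions *)

Section SubmodularSets.
Variables (R : realType) (E : finType) (f : {set E} -> R).
Hypotheses (f_mono : monotone f) (f_sub : submodular f).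

(** Since [Z] may meet [Y], the intersection of [X :|: Z] with [Y] may exceed [X]; monotonicity
    absorbs the difference. *)
Lemma submodular_diminishing (X Y Z : {set E}) :
  X \subset Y -> f (Y :|: Z) - f Y <= f (X :|: Z) - f X.
Proof.
move=> XY; have := f_sub (X :|: Z) Y.
have -> : X :|: Z :|: Y = Y :|: Z by rewrite setUAC (setUidPr XY).
have := f_mono X ((X :|: Z) :&: Y); rewrite subsetI subsetUl XY => /(_ isT).
by lra.
Qed.

Lemma submodular_union (Y X1 X2 : {set E}) :
  f (Y :|: (X1 :|: X2)) + f Y <= f (Y :|: X1) + f (Y :|: X2).
Proof.
have := submodular_diminishing Y (Y :|: X1) X2 (subsetUl _ _).
by rewrite -setUA; lra.
Qed.

End SubmodularSets.

(** * Symmetry of the uniformly random order *)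

Section RandomOrder.
Variables (R : realType) (N : finType).

(** Both lists are completed to enumerations of [N] by appending the missing elements; [t] matches
    the two enumerations position by position. *)
Lemma uniq_map_perm (e1 e2 : seq N) : uniq e1 -> uniq e2 -> size e1 = size e2 ->
  exists t : {perm N}, map t e1 = e2.
Proof.
move=> u1 u2 sz; have [s0|s0] := posnP (size e1).
  by exists 1%g; rewrite (size0nil s0) (size0nil (etrans (esym sz) s0)).
have x0 : N by case: (e1) s0 => // x.
pose ext (e : seq N) := e ++ [seq x <- enum N | x \notin e].
have extP e : uniq e -> uniq (ext e) /\ forall x, x \in ext e.
  move=> ue; split; last by move=> x; rewrite mem_cat mem_filter mem_enum andbT orbN.
  rewrite cat_uniq ue filter_uniq ?enum_uniq // andbT.
  by apply/hasPn => x; rewrite mem_filter => /andP[].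
have [U1 T1] := extP e1 u1; have [U2 T2] := extP e2 u2.
have SZ : size (ext e1) = size (ext e2).
  by apply: perm_size; apply: uniq_perm => // x; rewrite T1 T2.
have inj : injective (fun x => nth x (ext e2) (index x (ext e1))).
  move=> x y /eqP; have iy : (index y (ext e1) < size (ext e2))%N by rewrite -SZ index_mem.
  rewrite (set_nth_default x y) // nth_uniq // -?SZ ?index_mem // => /eqP ixy.
  by rewrite -(nth_index x (T1 x)) -(nth_index x (T1 y)) ixy.
exists (perm inj); apply: (@eq_from_nth _ x0); rewrite size_map // => i ie1.
rewrite (nth_map x0) // permE /ext index_cat mem_nth // index_uniq //.
by rewrite nth_cat -sz ie1; apply: set_nth_default; rewrite -sz.
Qed.

(** Translation by a permutation [t] carrying [e1] to [e2] is a bijection of the group, so both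
    images have the same distribution. *)
Lemma sum_perm_map (e1 e2 : seq N) (Phi : seq N -> R) :
  uniq e1 -> uniq e2 -> size e1 = size e2 ->
  \sum_(s : {perm N}) Phi (map s e1) = \sum_(s : {perm N}) Phi (map s e2).
Proof.
move=> u1 u2 sz; have [t <-] := uniq_map_perm _ _ u1 u2 sz.
rewrite (reindex_inj (mulgI t)) /=; apply: eq_bigr => s _.
by rewrite -map_comp; congr Phi; apply: eq_map => x; rewrite /= permM.
Qed.

Lemma sum_const_perm (w : R) :
  \sum_(s : {perm N}) w = #|{: {perm N}}|%:R * w.
Proof. by rewrite sumr_const mulr_natl. Qed.

End RandomOrder.

(** * Arithmetic of the split lengths *)

(* r = 3n/7 optimises the final bound, whose limit for large n is then 57/112. *)
Lemma balanced_split n : exists r m1 m2 : nat,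
  [/\ (r + m1 + m2 = n)%N, (3 * n <= 7 * r + 3)%N, (7 * r <= 3 * n + 3)%N,
      (m1 <= m2)%N & (m2 <= m1.+1)%N].
Proof.
pose r := ((3 * n + 3) %/ 7)%N.
by exists r, ((n - r) %/ 2)%N, (n - r - (n - r) %/ 2)%N; split; lia.
Qed.

(** The left side equals [6/7 q^2 - 2 q + (7 r - 3 q)^2 / 14 + (y - x)^2 / 2], so rounding costs at
    most a constant. The factor 573/625 is 9 - 16 * 1263/2500, exactly what [greedy_ratio] can
    afford. *)
Lemma rounding_bound (R : realType) (q r x y : R) : q = r + x + y -> 2 <= q ->
  3 * q - 3 <= 7 * r -> 7 * r <= 3 * q + 3 -> x <= y -> y <= x + 1 ->
  (x + y) * (x + y - 1) + y * (y - 1) + x * (x - 1) + 2 * (r * (r - 1))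
    <= 573 / 625 * (q * (q - 1)).
Proof.
move=> qE q2 rlo rhi xy yx.
have rsq : 0 <= (3 - (7 * r - 3 * q)) * (3 + (7 * r - 3 * q)).
  by apply: mulr_ge0; lra.
have msq : 0 <= (1 - (y - x)) * (1 + (y - x)) by apply: mulr_ge0; lra.
have qsq : 0 <= q * (q - 2) by apply: mulr_ge0; lra.
have yE : y = q - r - x by lra.
by rewrite yE in msq *; lra.
Qed.

(** * Greedy as a set of pairs, and the charging bound *)

Section Greedy.
Variables (R : realType) (M N : finType) (v : M -> {set N} -> R).
Variable g : online_rule M N.
Hypotheses (val_v : forall l, valuation (v l)) (greedy_g : greedy v g).

Definition pair_welfare (X : {set M * N}) : R :=
  welfare v (fun l => [set j | (l, j) \in X]).

Local Notation f := pair_welfare.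

Lemma pair_welfare_ge0 X : 0 <= f X.
Proof. by apply: sumr_ge0 => l _; case: (val_v l). Qed.

Lemma pair_welfare0 : f set0 = 0.
Proof.
apply: big1 => l _; case: (val_v l) => _ v0 _ _; rewrite -[RHS]v0.
by congr (v l _); apply/setP => j; rewrite !inE.
Qed.

Lemma pair_welfare_monotone : monotone f.
Proof.
move=> X Y XY; apply: ler_sum => l _; case: (val_v l) => _ _ mono _.
by apply: mono; apply/subsetP => j; rewrite !inE; apply: (subsetP XY).
Qed.

Lemma pair_welfare_submodular : submodular f.
Proof.
move=> X Y; rewrite /pair_welfare /welfare -!big_split /=.
apply: ler_sum => l _; case: (val_v l) => _ _ _ sub.
apply: le_trans (sub _ _); rewrite le_eqVlt; apply/orP; left; apply/eqP.
by congr (v l _ + v l _); apply/setP => j; rewrite !inE.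
Qed.

(** A form shared by the competing solution and by Greedy's own allocation, so that a Greedy run on
    another sequence can be charged as well. *)
Definition selection (b : N -> M) (h : seq N) : {set M * N} :=
  [set x | (x.2 \in h) && (b x.2 == x.1)].

Definition greedy_owner (h : seq N) (j : N) : M := g (take (index j h) h) j.

Definition greedy_set (h : seq N) : {set M * N} := selection (greedy_owner h) h.

Local Notation A := greedy_set.

Lemma selection_cat b h1 h2 :
  selection b (h1 ++ h2) = selection b h1 :|: selection b h2.
Proof. by apply/setP => x; rewrite !inE mem_cat andb_orl. Qed.

Lemma selection_rcons b h j :
  selection b (rcons h j) = selection b h :|: [set (b j, j)].
Proof.
apply/setP => -[l i]; rewrite !inE mem_rcons inE /= xpair_eqE andb_orl orbC.
by case: (eqVneq i j) => [->|]; rewrite ?andbT ?andbF // eq_sym.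
Qed.

Lemma in_greedy_set h l j : ((l, j) \in A h) = (j \in bundle g h l).
Proof. by rewrite !inE. Qed.

Lemma pair_welfare_greedy h : f (A h) = welfare v (bundle g h).
Proof.
by apply: eq_bigr => l _; congr (v l _); apply/setP => j; rewrite in_set in_greedy_set.
Qed.

Lemma greedy_set_rcons h j : uniq (rcons h j) ->
  A (rcons h j) = A h :|: [set (g h j, j)].
Proof.
move=> u; apply/setP => -[l i].
rewrite in_greedy_set bundle_rcons // in_setU in_greedy_set in_set1 xpair_eqE.
rewrite (eq_sym l); case: eqP => _ /=; last by rewrite orbF.
by rewrite in_setU1 orbC.
Qed.

Lemma pair_welfare_marginal h l j :
  f (A h :|: [set (l, j)]) - f (A h) = marginal (v l) (bundle g h l) j.
Proof.
rewrite /pair_welfare /welfare !(bigD1 l (P := xpredT)) //=.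
set a := v l _; set b := \sum_(i | _) _; set c := v l _; set d := \sum_(i | _) _.
have -> : b = d.
  apply: eq_bigr => i il; congr (v i _); apply/setP => k.
  by rewrite !inE /= xpair_eqE (negbTE il) orbF.
have -> : c = v l (bundle g h l).
  by congr (v l _); apply/setP => k; rewrite in_set in_greedy_set.
have -> : a = v l (j |: bundle g h l).
  congr (v l _); apply/setP => k.
  by rewrite in_setU1 in_set in_setU in_greedy_set in_set1 xpair_eqE eqxx orbC.
by rewrite /marginal; lra.
Qed.

Lemma greedy_step h j l : uniq (rcons h j) ->
  f (A h :|: [set (l, j)]) - f (A h) <= f (A (rcons h j)) - f (A h).
Proof.
by move=> u; rewrite greedy_set_rcons // !pair_welfare_marginal; apply: greedy_g.
Qed.

Lemma greedy_set_prefix h1 h2 : uniq (h1 ++ h2) -> A h1 \subset A (h1 ++ h2).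
Proof.
elim/last_ind: h2 => [|h2 j IH]; first by rewrite cats0.
rewrite -rcons_cat => u; rewrite greedy_set_rcons //.
by move: u; rewrite rcons_uniq => /andP[_ /IH] s; apply: subset_trans s (subsetUl _ _).
Qed.

(* Each (b j, j) is charged to the greedy gain at the arrival of j. *)
Lemma greedy_charge b h1 h2 (X : {set M * N}) : uniq (h1 ++ h2) ->
  A (h1 ++ h2) \subset X ->
  f (X :|: selection b h2) <= f X + (f (A (h1 ++ h2)) - f (A h1)).
Proof.
elim/last_ind: h2 => [|h2 j IH].
  rewrite cats0 => _ _; have -> : selection b [::] = set0.
    by apply/setP => x; rewrite !inE.
  by rewrite setU0 subrr addr0.
rewrite -rcons_cat => u AX; have u' : uniq (h1 ++ h2).
  by move: u; rewrite rcons_uniq => /andP[].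
have AX' : A (h1 ++ h2) \subset X.
  apply: subset_trans AX; rewrite -cats1; apply: greedy_set_prefix.
  by rewrite cats1.
have := IH u' AX'; have := greedy_step _ _ (b j) u.
have := submodular_diminishing _ _ _ pair_welfare_monotone pair_welfare_submodular
  (A (h1 ++ h2)) (X :|: selection b h2) [set (b j, j)]
  (subset_trans AX' (subsetUl _ _)).
by rewrite selection_rcons setUA; lra.
Qed.

(** Left unnormalised: the expectation times the number of permutations, with the division deferred
    to the theorem. *)
Definition prefix_welfare (i : nat) : R :=
  \sum_(s : {perm N}) f (A (map s (take i (enum N)))).

Local Notation F := prefix_welfare.
Local Notation n := #|N|.

Lemma prefix_welfareE (h : seq N) : uniq h ->
  \sum_(s : {perm N}) f (A (map s h)) = F (size h).
Proof.
move=> u; apply: (sum_perm_map R N _ _ (fun h => f (A h))) => //.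
  by rewrite take_uniq // enum_uniq.
rewrite size_takel // -cardE -(card_uniqP u); exact: max_card.
Qed.

Lemma prefix_welfare0 : F 0 = 0.
Proof.
rewrite /prefix_welfare big1 // => s _; rewrite take0 /= -[RHS]pair_welfare0.
by congr f; apply/setP => x; rewrite !inE.
Qed.

(** * Comparison with a fixed competing assignment *)

Variable a : N -> M.
Local Notation O := (selection a).
Local Notation W := (f [set x | a x.2 == x.1]).
Local Notation K := (#|{: {perm N}}|%:R : R).

Lemma selection_total (h : seq N) : (forall x, x \in h) ->
  O h = [set x | a x.2 == x.1].
Proof. by move=> ht; apply/setP => x; rewrite !inE ht. Qed.

Lemma optimum_split (X : {set M * N}) h1 h2 : (forall x, x \in h1 ++ h2) ->
  W <= f (X :|: O h2 :|: O h1).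
Proof.
move=> ht; apply: pair_welfare_monotone; rewrite -(selection_total _ ht).
by rewrite selection_cat -setUA (setUC (O h2)) subsetUr.
Qed.

Lemma greedy_remaining h1 h2 : uniq h1 -> (forall x, x \in h1 ++ h2) ->
  W - f (A h1) <= f (A h1 :|: O h2).
Proof.
move=> u ht; have := optimum_split (A h1) _ _ ht.
have := greedy_charge a [::] h1 (A h1 :|: O h2) u (subsetUl _ _).
by have := pair_welfare_ge0 (A [::]); lra.
Qed.

Lemma selection_marginals (X : {set M * N}) h :
  f (X :|: O h) <= f X + \sum_(j <- h) (f (X :|: [set (a j, j)]) - f X).
Proof.
elim/last_ind: h => [|h j IH].
  rewrite big_nil addr0; have -> : O [::] = set0.
    by apply/setP => x; rewrite !inE.
  by rewrite setU0.
rewrite big_rcons /= selection_rcons; have := submodular_union _ _ _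
  pair_welfare_monotone pair_welfare_submodular X (O h) [set (a j, j)].
by lra.
Qed.

Lemma map_perm_total (s : {perm N}) h : (forall x, x \in h) ->
  forall x, x \in map s h.
Proof. by move=> ht x; rewrite -(permKV s x) map_f. Qed.

(** Each of the [k.+1] remaining items is equally likely to come next, and Greedy gains at least
    what giving it to its owner under [a] would; these marginals sum to at least what
    [greedy_remaining] leaves available. *)
Lemma prefix_welfare_rate i k : (i + k.+1)%N = n ->
  K * W - 2 * F i <= k.+1%:R * (F i.+1 - F i).
Proof.
move=> ik.
set e1 := take i (enum N); set e2 := drop i (enum N).
have ht x : x \in e1 ++ e2 by rewrite cat_take_drop mem_enum.
have u12 : uniq (e1 ++ e2) by rewrite cat_take_drop enum_uniq.
have sz : size (enum N) = n by rewrite -cardE.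
have sz1 : size e1 = i by rewrite size_takel // sz; lia.
have sz2 : size e2 = k.+1 by rewrite size_drop sz; lia.
have u1 : uniq e1 by move: u12; rewrite cat_uniq => /andP[].
have H1 (s : {perm N}) : W - 2 * f (A (map s e1)) <=
    \sum_(j <- e2) (f (A (map s (rcons e1 j))) - f (A (map s e1))).
  have us : uniq (map s e1) by rewrite map_inj_uniq //; exact: perm_inj.
  have hs x : x \in map s e1 ++ map s e2 by rewrite -map_cat map_perm_total.
  have B1 := greedy_remaining _ _ us hs.
  have B2 := selection_marginals (A (map s e1)) (map s e2).
  rewrite big_map in B2.
  have B3 : \sum_(j <- e2)
      (f (A (map s e1) :|: [set (a (s j), s j)]) - f (A (map s e1))) <=
      \sum_(j <- e2) (f (A (map s (rcons e1 j))) - f (A (map s e1))).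
    rewrite !big_seq; apply: ler_sum => j je; rewrite map_rcons; apply: greedy_step.
    rewrite -map_rcons map_inj_uniq; last exact: perm_inj.
    rewrite rcons_uniq u1 andbT.
    by move: u12; rewrite cat_uniq => /and3P[_ /hasPn/(_ j je)].
  by lra.
have := @ler_sum _ _ (index_enum {perm N}) xpredT _ _ (fun s _ => H1 s).
rewrite sumrB sum_const_perm -mulr_sumr prefix_welfareE // sz1 exchange_big /=.
(* Each [rcons e1 j] is duplicate-free of length [i.+1], so after averaging all [j] contribute
   equally. *)
suff -> : \sum_(j <- e2) \sum_(s : {perm N})
    (f (A (map s (rcons e1 j))) - f (A (map s e1))) = k.+1%:R * (F i.+1 - F i) by [].
transitivity (\sum_(j <- e2) (F i.+1 - F i)); last first.
  by rewrite big_const_seq count_predT iter_addr_0 sz2 mulr_natl.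
rewrite !big_seq; apply: eq_bigr => j je.
rewrite sumrB !prefix_welfareE // ?size_rcons ?sz1 // rcons_uniq u1 andbT.
by move: u12; rewrite cat_uniq => /and3P[_ /hasPn/(_ j je)].
Qed.

Lemma prefix_welfare_mono i : (i < n)%N -> F i <= F i.+1.
Proof.
move=> ltin; apply: ler_sum => s _; apply: pair_welfare_monotone.
have /card_gt0P[x0 _] : (0 < n)%N by lia.
rewrite (take_nth x0) -?cardE // map_rcons -cats1; apply: greedy_set_prefix.
rewrite cats1 -map_rcons -take_nth -?cardE // map_inj_uniq ?take_uniq ?enum_uniq //.
exact: perm_inj.
Qed.

(** Writing [D i] for [K * W - 2 * F i], the rate reads [D i.+1 <= (1 - 2 / (n - i)) * D i], and the
    product of these factors telescopes. *)
Lemma prefix_welfare_bound i k : (i + k)%N = n ->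
  n%:R * (n%:R - 1) * (K * W - 2 * F i) <= K * W * (k%:R * (k%:R - 1)).
Proof.
elim: i k => [|i IH] k ik.
  by rewrite add0n in ik; rewrite prefix_welfare0 ik mulr0 subr0 mulrC.
have ik' : (i + k.+1)%N = n by lia.
have := IH _ ik'; have rate := prefix_welfare_rate _ _ ik'.
have n1 : 1 <= n%:R :> R by rewrite ler1n; lia.
have : 0 <= n%:R * (n%:R - 1) :> R by nra.
move: (n%:R * (n%:R - 1) : R) => c c0 IHi.
(* At the last arrival the factor is -1 and cannot multiply the induction hypothesis; the right side
   is then already 0 and monotonicity of [F] suffices. *)
case: k ik ik' rate IHi => [|k] ik ik' rate IHi.
  have := prefix_welfare_mono i; rewrite -ik addn0 ltnSn => /(_ isT).
  by nra.
have k0 : 0 <= k%:R :> R by [].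
move: rate IHi; rewrite -!natr1 => rate IHi.
have k2 : 0 < k%:R + 1 + 1 :> R by lra.
rewrite -(ler_pM2l k2).
have H1 : (k%:R + 1 + 1) * (K * W - 2 * F i.+1) <= k%:R * (K * W - 2 * F i).
  by lra.
have H2 := ler_wpM2l c0 H1; have H3 := ler_wpM2l k0 IHi.
by lra.
Qed.

(** * Beating one half *)

(* A greedy run on h1, ha, hb is compared with two alternatives at once: the
   optimum on ha and hb, and the owners b on hb. *)
Lemma greedy_triple b h1 ha hb h2 : uniq (h1 ++ ha ++ hb) -> h2 =i ha ++ hb ->
  f (A h1 :|: O h2 :|: selection b hb) + f (A h1) + f (A (h1 ++ ha))
    <= 3 * f (A (h1 ++ ha ++ hb)).
Proof.
move=> u h2E; set G := A (h1 ++ ha ++ hb).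
have -> : O h2 = O (ha ++ hb) by apply/setP => x; rewrite !inE h2E mem_cat.
have := greedy_charge a h1 (ha ++ hb) G u (subxx _).
have := greedy_charge b (h1 ++ ha) hb (G :|: O (ha ++ hb)).
rewrite -catA => /(_ u (subsetUl _ _)).
have : f (A h1 :|: O (ha ++ hb) :|: selection b hb)
    <= f (G :|: O (ha ++ hb) :|: selection b hb).
  apply: pair_welfare_monotone; rewrite !setSU //.
  exact: greedy_set_prefix.
by rewrite -/G; lra.
Qed.

(** Submodularity over [A h2] separates [O h2] from [O h1], and [O h1] is charged to the gains made
    after [h2]. *)
Lemma greedy_self_union h1 h2 : uniq (h2 ++ h1) -> (forall x, x \in h1 ++ h2) ->
  W + 2 * f (A h2) <= f (A h2 :|: O h2) + 2 * f (A (h2 ++ h1)).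
Proof.
move=> u ht.
have := greedy_charge a h2 h1 (A (h2 ++ h1)) u (subxx _).
have : f (A h2 :|: O h1) <= f (A (h2 ++ h1) :|: O h1).
  by apply: pair_welfare_monotone; rewrite setSU // greedy_set_prefix.
have := submodular_union _ _ _ pair_welfare_monotone pair_welfare_submodular
  (A h2) (O h2) (O h1).
by have := optimum_split (A h2) _ _ ht; rewrite setUA; lra.
Qed.

Lemma halving_pointwise h1 ha hb : uniq (h1 ++ ha ++ hb) ->
  (forall x, x \in h1 ++ ha ++ hb) ->
  2 * W + f (A h1) + f (A (h1 ++ ha)) + f (A (h1 ++ hb)) + 2 * f (A (ha ++ hb))
    <= 3 * f (A (h1 ++ ha ++ hb)) + 3 * f (A (h1 ++ hb ++ ha))
       + 2 * f (A ((ha ++ hb) ++ h1)).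
Proof.
move=> u ht; set h2 := ha ++ hb; pose b := greedy_owner h2.
have u1 : uniq h1 by move: u; rewrite cat_uniq => /andP[].
have u' : uniq (h1 ++ hb ++ ha).
  by rewrite (perm_uniq (s2 := h1 ++ ha ++ hb)) // perm_cat2l perm_catC.
have Ta := greedy_triple b h1 ha hb h2 u (fun=> erefl).
have Tb := greedy_triple b h1 hb ha h2 u'.
have {}Tb := Tb (fun x => etrans (mem_cat x ha hb)
  (etrans (orbC _ _) (esym (mem_cat x hb ha)))).
(* Joining the two halves of [A h2] leaves a spare [f (A h1 :|: O h2)]. By [greedy_remaining] it
   yields the second [W], at the price of one of the two copies of [f (A h1)] in [Ta] and [Tb]. *)
have := submodular_union _ _ _ pair_welfare_monotone pair_welfare_submodular
  (A h1 :|: O h2) (selection b ha) (selection b hb).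
rewrite -selection_cat -/h2 -/(A h2) => S1.
have S2 : f (A h2 :|: O h2) <= f (A h1 :|: O h2 :|: A h2).
  by apply: pair_welfare_monotone; rewrite -setUA (setUC (O h2)) subsetUr.
have := greedy_self_union h1 h2; rewrite uniq_catC => /(_ u ht).
have := greedy_remaining _ _ u1 ht.
by lra.
Qed.

Lemma halving_inequality r m1 m2 : (r + m1 + m2)%N = n ->
  2 * (K * W) + F r + F (r + m1) + F (r + m2) + 2 * F (m1 + m2) <= 8 * F n.
Proof.
move=> rm; set e := enum N.
pose e1 := take r e; pose ea := take m1 (drop r e); pose eb := drop m1 (drop r e).
have eE : e1 ++ ea ++ eb = e by rewrite !cat_take_drop.
have ht x : x \in e1 ++ ea ++ eb by rewrite eE mem_enum.
have u : uniq (e1 ++ ea ++ eb) by rewrite eE enum_uniq.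
have sz : size e = n by rewrite -cardE.
have sz1 : size e1 = r by rewrite size_takel // sz; lia.
have sza : size ea = m1 by rewrite size_takel // size_drop sz; lia.
have szb : size eb = m2 by rewrite !size_drop sz; lia.
have perm_u h : perm_eq h (e1 ++ ea ++ eb) -> uniq h.
  by move=> p; rewrite (perm_uniq p).
have ub : uniq (e1 ++ eb ++ ea) by apply: perm_u; rewrite perm_cat2l perm_catC.
have uc : uniq ((ea ++ eb) ++ e1) by apply: perm_u; rewrite perm_catC.
have H (s : {perm N}) := halving_pointwise (map s e1) (map s ea) (map s eb).
have {}H (s : {perm N}) : 2 * W + f (A (map s e1)) + f (A (map s (e1 ++ ea)))
    + f (A (map s (e1 ++ eb))) + 2 * f (A (map s (ea ++ eb)))
    <= 3 * f (A (map s (e1 ++ ea ++ eb))) + 3 * f (A (map s (e1 ++ eb ++ ea)))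
       + 2 * f (A (map s ((ea ++ eb) ++ e1))).
  rewrite !map_cat; apply: H; last by move=> x; rewrite -!map_cat map_perm_total.
  by rewrite -!map_cat map_inj_uniq //; exact: perm_inj.
have := @ler_sum _ _ (index_enum {perm N}) xpredT _ _ (fun s _ => H s).
have ua : uniq (e1 ++ ea) by move: u; rewrite catA cat_uniq => /andP[].
have ub' : uniq (e1 ++ eb) by move: ub; rewrite catA cat_uniq => /andP[].
have u2 : uniq (ea ++ eb) by move: uc; rewrite cat_uniq => /andP[].
have u1 : uniq e1 by move: ua; rewrite cat_uniq => /andP[].
rewrite !big_split /= -!mulr_sumr sum_const_perm.
rewrite !prefix_welfareE // !size_cat sz1 sza szb.
(* The three orders of all items each average to [F n], with total weight 3 + 3 + 2 = 8. *)
have -> : (r + (m1 + m2))%N = n by lia.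
have -> : (r + (m2 + m1))%N = n by lia.
have -> : (m1 + m2 + r)%N = n by lia.
by lra.
Qed.

Lemma prefix_welfare_full :
  \sum_(s : {perm N}) welfare v (bundle g (arrival_order s)) = F n.
Proof.
by apply: eq_bigr => s _; rewrite -pair_welfare_greedy cardE take_size.
Qed.

Lemma expected_welfare_ge0 : 0 <= expected_welfare v g.
Proof.
apply: divr_ge0 => //; rewrite prefix_welfare_full.
by apply: sumr_ge0 => s _; apply: pair_welfare_ge0.
Qed.

Lemma greedy_ratio : 1263 / 2500 * (K * W) <= F n.
Proof.
(* For [n] at most 1 the factor [n (n - 1)] vanishes and [prefix_welfare_bound] says nothing. *)
have [n0|n0] := posnP n.
  by have := @halving_inequality 0 0 0 (esym n0); rewrite n0 prefix_welfare0; lra.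
have KW0 : 0 <= K * W by rewrite mulr_ge0 ?pair_welfare_ge0.
have [n1|n1] := eqVneq n 1%N.
  by have := @prefix_welfare_rate 0 0 (esym n1); rewrite n1 prefix_welfare0; lra.
have n2 : (2 <= n)%N by lia.
have [r [m1 [m2 [rm rlo rhi mlo mhi]]]] := balanced_split n.
have n2R : 2 <= n%:R :> R by rewrite ler_nat.
(* The errors of [prefix_welfare_bound] at the four prefix lengths, weighted as in
   [halving_inequality]. *)
have Q : (m1%:R + m2%:R) * (m1%:R + m2%:R - 1) + m2%:R * (m2%:R - 1)
    + m1%:R * (m1%:R - 1) + 2 * (r%:R * (r%:R - 1))
    <= 573 / 625 * (n%:R * (n%:R - 1)) :> R.
  apply: rounding_bound => //; rewrite ?natr1 -?natrM -?natrD ?ler_nat ?rm //.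
  by rewrite lerBlDr -natrD ler_nat.
have H := halving_inequality _ _ _ rm.
have B1 := prefix_welfare_bound r (m1 + m2) (etrans (addnA _ _ _) rm).
have B2 := prefix_welfare_bound (r + m1) m2 rm.
have B3 := prefix_welfare_bound (r + m2) m1 (etrans (addnAC _ _ _) rm).
have B4 := prefix_welfare_bound (m1 + m2) r
  (etrans (addnC _ _) (etrans (addnA _ _ _) rm)).
have c0 : 0 < n%:R * (n%:R - 1) :> R by rewrite mulr_gt0 ?subr_gt0 ?ltr1n ?ltr0n.
rewrite natrD in B1; rewrite -(ler_pM2l c0).
have := ler_wpM2l KW0 Q; have := ler_wpM2l (ltW c0) H.
by lra.
Qed.

End Greedy.

(* 0.5052 = 1263 / 2500 *)
Theorem theorem1p1 (R : realType) (M N : finType) (v : M -> {set N} -> R)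
  (g : online_rule M N) :
  (forall l : M, valuation (v l)) ->
  greedy v g ->
  1263 / 2500 * OPT v <= expected_welfare v g.
Proof.
move=> val_v greedy_g.
have K0 : 0 < #|{: {perm N}}|%:R :> R.
  by rewrite ltr0n; apply/card_gt0P; exists 1%g.
have ratio0 : 0 < 1263 / 2500 :> R by lra.
rewrite mulrC -ler_pdivlMr //; apply: bigmax_le => [|a _].
  by rewrite divr_ge0 ?(ltW ratio0) // expected_welfare_ge0.
rewrite ler_pdivlMr // mulrC /expected_welfare ler_pdivlMr // prefix_welfare_full.
have -> : welfare v (fun l => [set j | a j == l])
    = pair_welfare R M N v [set x | a x.2 == x.1].
  by apply: eq_bigr => l _; congr (v l _); apply/setP => j; rewrite !inE.
by rewrite -mulrA [pair_welfare _ _ _ _ _ * _]mulrC; apply: greedy_ratio.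
Qed.
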